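(* For any virtual knot $K$, the second and third terms of the lower central series of its Kauffman group coincide: $\gamma_2(G_{Ka}(K)) = \gamma_3(G_{Ka}(K))$.
   Context: Lower central series: $\gamma_1(G)=G$, $\gamma_{i+1}(G)=[\gamma_i(G),G]$. Conjugation: $x^{y}=y^{-1}xy$. The virtual braid group $VB_n$ is generated by $\sigma_1,\dots,\sigma_{n-1},\rho_1,\dots,\rho_{n-1}$ with relations: $\sigma_i\sigma_{i+1}\sigma_i=\sigma_{i+1}\sigma_i\sigma_{i+1}$; $\sigma_i\sigma_j=\sigma_j\sigma_i$ for $|i-j|\ge 2$; $\rho_i^2=1$; $\rho_i\rho_j=\rho_j\rho_i$ for $|i-j|\ge2$; $\rho_i\rho_{i+1}\rho_i=\rho_{i+1}\rho_i\rho_{i+1}$; $\sigma_i\rho_j=\rho_j\sigma_i$ for $|i-j|\ge 2$; $\rho_i\rho_{i+1}\sigma_i=\sigma_{i+1}\rho_i\rho_{i+1}$. Let $F_{n+1}=\langle x_1,\dots,x_n,y\rangle$ be the free group of rank $n+1$. The representation $\varphi_A:VB_n\to\operatorname{Aut}(F_{n+1})$ is given by: $\varphi_A(\sigma_i)$ sends $x_i\mapsto x_ix_{i+1}x_i^{-1}$, $x_{i+1}\mapsto x_i$, and fixes $y$ and all other $x_j$; $\varphi_A(\rho_i)$ sends $x_i\mapsto x_{i+1}^{y^{-1}}$, $x_{i+1}\mapsto x_i^{y}$, and fixes $y$ and all other $x_j$. Automorphisms act on the right, i.e. for a word in the generators of $VB_n$ the automorphism of the leftmost letter is applied first. Every virtual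 link is equivalent to the closure of some virtual braid $\beta\in VB_n$; the closure is a virtual knot (one component) exactly when the image of $\beta$ under the homomorphism $VB_n\to S_n$, $\sigma_i,\rho_i\mapsto (i,i+1)$, is an $n$-cycle. If $K$ is the closure of $\beta$, put $G_A(K)=\langle x_1,\dots,x_n,y \mid x_i=\varphi_A(\beta)(x_i),\ i=1,\dots,n\rangle$; up to isomorphism this depends only on $K$. The Kauffman group $G_{Ka}(K)$ is the quotient of $G_A(K)$ by the relation $y=1$ (equivalently, the Wirtinger group of a virtual knot diagram in which virtual crossings are ignored). *)

(* Defs.v *)
From HB Require Import structures.
From mathcomp Require Import all_boot all_fingroup generic_quotient.
From mathcomp Require Import boolp classical_sets.

Set Implicit Arguments.
Unset Strict Implicit.
Unset Printing Implicit Defensive.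

Local Open Scope group_scope.
Local Open Scope quotient_scope.

Section MorphismFacts.
Variables (G H : groupType) (f : {multiplicative G -> H}).

Lemma hom1 : f 1 = 1.
Proof. by apply: (@mulgI _ (f 1)); rewrite -gmulfM !mulg1. Qed.

Lemma homV x : f x^-1 = (f x)^-1.
Proof. by apply: (@mulgI _ (f x)); rewrite -gmulfM !mulgV hom1. Qed.

End MorphismFacts.

(* Quotient of a group by the smallest congruence containing R, i.e. the
   group obtained from G by imposing the relations u = v for R u v. *)
Section Quotient.
Variables (G : groupType) (R : G -> G -> Prop).

Inductive congr : G -> G -> Prop :=
| congr_base u v of R u v : congr u v
| congr_refl u : congr u u
| congr_sym u v of congr u v : congr v u
| congr_trans v u w of congr u v & congr v w : congr u w
| congr_mul u v u' v' of congr u v & congr u' v' : congr (u * u') (v * v').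

Definition congrb (u v : G) : bool := `[< congr u v >].

Lemma congrb_refl : reflexive congrb.
Proof. by move=> u; apply/asboolP; apply: congr_refl. Qed.
Lemma congrb_sym : symmetric congrb.
Proof.
by move=> u v; apply/idP/idP => /asboolP h; apply/asboolP; apply: congr_sym.
Qed.
Lemma congrb_trans : transitive congrb.
Proof.
move=> v u w /asboolP h /asboolP h'; apply/asboolP; exact: congr_trans h h'.
Qed.

Canonical congrb_equiv := EquivRel congrb congrb_refl congrb_sym congrb_trans.

Definition quot : Type := {eq_quot congrb_equiv}.
HB.instance Definition _ := Choice.on quot.

Definition quot_pi (u : G) : quot := \pi_{eq_quot congrb_equiv} u.
Definition quot_repr (q : quot) : G := repr (q : {eq_quot congrb_equiv}).

Lemma quot_reprK q : quot_pi (quot_repr q) = q.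
Proof. exact: reprK. Qed.

Lemma quot_piP u v : quot_pi u = quot_pi v <-> congr u v.
Proof.
split; first by move=> /eqmodP /asboolP.
by move=> h; apply/eqmodP/asboolP.
Qed.

Lemma quot_repr_pi u : congr (quot_repr (quot_pi u)) u.
Proof. by apply/quot_piP; rewrite quot_reprK. Qed.

Lemma congr_inv u v : congr u v -> congr u^-1 v^-1.
Proof.
move=> h; apply: congr_sym.
have := congr_mul (congr_mul (congr_refl u^-1) h) (congr_refl v^-1).
by rewrite mulVg mul1g -mulgA mulgV mulg1.
Qed.

Definition quot_mul (p q : quot) := quot_pi (quot_repr p * quot_repr q).
Definition quot_inv (p : quot) := quot_pi (quot_repr p)^-1.

Lemma quot_piM_subproof u v : quot_pi (u * v) = quot_mul (quot_pi u) (quot_pi v).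
Proof.
by apply/quot_piP/congr_sym/congr_mul; apply: quot_repr_pi.
Qed.
Lemma quot_piV_subproof u : quot_pi u^-1 = quot_inv (quot_pi u).
Proof. by apply/quot_piP/congr_sym/congr_inv; apply: quot_repr_pi. Qed.

Lemma quot_mulA : associative quot_mul.
Proof.
move=> p q r; rewrite -(quot_reprK p) -(quot_reprK q) -(quot_reprK r).
by rewrite -!quot_piM_subproof mulgA.
Qed.
Lemma quot_mul1 : left_id (quot_pi 1) quot_mul.
Proof. by move=> p; rewrite -(quot_reprK p) -quot_piM_subproof mul1g. Qed.
Lemma quot_1mul : right_id (quot_pi 1) quot_mul.
Proof. by move=> p; rewrite -(quot_reprK p) -quot_piM_subproof mulg1. Qed.
Lemma quot_mulVg : left_inverse (quot_pi 1) quot_inv quot_mul.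
Proof.
move=> p; rewrite -(quot_reprK p) -quot_piV_subproof.
by rewrite -quot_piM_subproof mulVg.
Qed.
Lemma quot_mulgV : right_inverse (quot_pi 1) quot_inv quot_mul.
Proof.
move=> p; rewrite -(quot_reprK p) -quot_piV_subproof.
by rewrite -quot_piM_subproof mulgV.
Qed.

HB.instance Definition _ :=
  isGroup.Build quot quot_mulA quot_mul1 quot_1mul quot_mulVg quot_mulgV.
HB.instance Definition _ := isMultiplicative.Build G quot quot_pi quot_piM_subproof.

Section Lift.
Variables (H : groupType) (f : {multiplicative G -> H}).
Hypothesis fR : forall u v, R u v -> f u = f v.

Lemma congr_hom u v : congr u v -> f u = f v.
Proof.
elim=> // {u v} [v u w _ -> _ -> //|u v u' v' _ e _ e'].
by rewrite !gmulfM e e'.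
Qed.

(* The compatibility proof is a formal argument, so that quot_lift can carry a
   canonical morphism structure. *)
Definition quot_lift (_ : forall u v, R u v -> f u = f v) (q : quot) : H :=
  f (quot_repr q).

Lemma quot_liftE u : quot_lift fR (quot_pi u) = f u.
Proof. exact/congr_hom/quot_repr_pi. Qed.

Lemma quot_liftM : {morph quot_lift fR : p q / p * q}.
Proof.
move=> p q; rewrite -(quot_reprK p) -(quot_reprK q) -gmulfM.
by rewrite !quot_liftE gmulfM.
Qed.

HB.instance Definition _ :=
  isMultiplicative.Build quot H (quot_lift fR) quot_liftM.

End Lift.
End Quotient.

(* Free group on X: words in letters (x, b), standing for x if b = false and
   for x^-1 if b = true, up to cancellation of adjacent inverse letters. *)
Section FreeGroup.
Variable X : choiceType.
Let word := seq (X * bool).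

Inductive wequiv : word -> word -> Prop :=
| wequiv_cancel u v x b : wequiv (u ++ [:: (x, b); (x, ~~ b)] ++ v) (u ++ v)
| wequiv_refl u : wequiv u u
| wequiv_sym u v of wequiv u v : wequiv v u
| wequiv_trans v u w of wequiv u v & wequiv v w : wequiv u w.

Definition wequivb (u v : word) : bool := `[< wequiv u v >].

Lemma wequivb_refl : reflexive wequivb.
Proof. by move=> u; apply/asboolP; apply: wequiv_refl. Qed.
Lemma wequivb_sym : symmetric wequivb.
Proof.
by move=> u v; apply/idP/idP => /asboolP h; apply/asboolP; apply: wequiv_sym.
Qed.
Lemma wequivb_trans : transitive wequivb.
Proof.
move=> v u w /asboolP h /asboolP h'; apply/asboolP; exact: wequiv_trans h h'.
Qed.

Canonical wequivb_equiv :=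
  EquivRel wequivb wequivb_refl wequivb_sym wequivb_trans.

Definition free : Type := {eq_quot wequivb_equiv}.
HB.instance Definition _ := Choice.on free.

Definition free_pi (u : word) : free := \pi_{eq_quot wequivb_equiv} u.
Definition free_repr (q : free) : word := repr (q : {eq_quot wequivb_equiv}).

Lemma free_reprK q : free_pi (free_repr q) = q.
Proof. exact: reprK. Qed.

Lemma free_piP u v : free_pi u = free_pi v <-> wequiv u v.
Proof.
split; first by move=> /eqmodP /asboolP.
by move=> h; apply/eqmodP/asboolP.
Qed.

Lemma free_repr_pi u : wequiv (free_repr (free_pi u)) u.
Proof. by apply/free_piP; rewrite free_reprK. Qed.

Lemma wequiv_catl w u v : wequiv u v -> wequiv (w ++ u) (w ++ v).
Proof.
elim=> {u v} [u v x b|u|u v _|v u s _ h _]; last exact: wequiv_trans.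
- by rewrite !(catA w); apply: wequiv_cancel.
- exact: wequiv_refl.
- exact: wequiv_sym.
Qed.

Lemma wequiv_catr w u v : wequiv u v -> wequiv (u ++ w) (v ++ w).
Proof.
elim=> {u v} [u v x b|u|u v _|v u s _ h _]; last exact: wequiv_trans.
- by rewrite -!catA; apply: wequiv_cancel.
- exact: wequiv_refl.
- exact: wequiv_sym.
Qed.

Lemma wequiv_cat u v u' v' :
  wequiv u v -> wequiv u' v' -> wequiv (u ++ u') (v ++ v').
Proof.
by move=> h h'; apply: wequiv_trans (wequiv_catr u' h) (wequiv_catl v h').
Qed.

Definition winv (u : word) : word := rev [seq (a.1, ~~ a.2) | a <- u].

Lemma winv_cat u v : winv (u ++ v) = winv v ++ winv u.
Proof. by rewrite /winv map_cat rev_cat. Qed.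

Lemma wequiv_inv u v : wequiv u v -> wequiv (winv u) (winv v).
Proof.
elim=> {u v} [u v x b|u|u v _|v u s _ h _]; last exact: wequiv_trans.
- rewrite !winv_cat -catA {2}/winv /rev /= negbK.
  exact: wequiv_cancel.
- exact: wequiv_refl.
- exact: wequiv_sym.
Qed.

Lemma wequiv_mulVw u : wequiv (winv u ++ u) [::].
Proof.
elim: u => [|[x b] u IHu]; first exact: wequiv_refl.
rewrite -cat1s winv_cat -catA /winv /=.
apply: wequiv_trans IHu; rewrite /rev /=.
by have := wequiv_cancel (winv u) u x (~~ b); rewrite negbK.
Qed.

Lemma winvK u : winv (winv u) = u.
Proof.
rewrite /winv map_rev revK -map_comp -[RHS]map_id; apply: eq_map => -[x b] /=.
by rewrite negbK.
Qed.

Definition free_mul (p q : free) := free_pi (free_repr p ++ free_repr q).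
Definition free_inv (p : free) := free_pi (winv (free_repr p)).

Lemma free_piM u v : free_pi (u ++ v) = free_mul (free_pi u) (free_pi v).
Proof. by apply/free_piP/wequiv_sym/wequiv_cat; apply: free_repr_pi. Qed.
Lemma free_piV u : free_pi (winv u) = free_inv (free_pi u).
Proof. by apply/free_piP/wequiv_sym/wequiv_inv; apply: free_repr_pi. Qed.

Lemma free_mulA : associative free_mul.
Proof.
move=> p q r; rewrite -(free_reprK p) -(free_reprK q) -(free_reprK r).
by rewrite -!free_piM catA.
Qed.
Lemma free_mul1 : left_id (free_pi [::]) free_mul.
Proof. by move=> p; rewrite -(free_reprK p) -free_piM. Qed.
Lemma free_1mul : right_id (free_pi [::]) free_mul.
Proof. by move=> p; rewrite -(free_reprK p) -free_piM cats0. Qed.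
Lemma free_mulVg : left_inverse (free_pi [::]) free_inv free_mul.
Proof.
move=> p; rewrite -(free_reprK p) -free_piV -free_piM.
exact/free_piP/wequiv_mulVw.
Qed.
Lemma free_mulgV : right_inverse (free_pi [::]) free_inv free_mul.
Proof.
move=> p; rewrite -(free_reprK p) -free_piV -free_piM; apply/free_piP.
by rewrite -{1}(winvK (free_repr p)); apply: wequiv_mulVw.
Qed.

HB.instance Definition _ :=
  isGroup.Build free free_mulA free_mul1 free_1mul free_mulVg free_mulgV.

Lemma free_pi_cat u v : free_pi (u ++ v) = free_pi u * free_pi v.
Proof. exact: free_piM. Qed.

Definition fgen (x : X) : free := free_pi [:: (x, false)].

Lemma free_pi_cons x b u :
  free_pi ((x, b) :: u) = (if b then (fgen x)^-1 else fgen x) * free_pi u.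
Proof.
rewrite -cat1s free_pi_cat; case: b => //.
by rewrite [(fgen x)^-1](_ : _ = free_pi (winv [:: (x, false)])) // free_piV.
Qed.

Section Lift.
Variables (H : groupType) (f : X -> H).

Definition word_eval (u : word) : H :=
  \prod_(a <- u) (if a.2 then (f a.1)^-1 else f a.1).

Lemma word_eval_cat u v : word_eval (u ++ v) = word_eval u * word_eval v.
Proof. exact: big_cat. Qed.

Lemma word_eval_equiv u v : wequiv u v -> word_eval u = word_eval v.
Proof.
elim=> // {u v} [u v x b|v u w _ -> //].
rewrite !word_eval_cat /word_eval !big_cons big_nil /=.
by case: b; rewrite mulg1 ?mulVg ?mulgV mul1g.
Qed.

Definition free_lift (p : free) : H := word_eval (free_repr p).

Lemma free_lift_pi u : free_lift (free_pi u) = word_eval u.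
Proof. exact/word_eval_equiv/free_repr_pi. Qed.

Lemma free_lift_gen x : free_lift (fgen x) = f x.
Proof. by rewrite free_lift_pi /word_eval big_seq1. Qed.

Lemma free_liftM : {morph free_lift : p q / p * q}.
Proof.
move=> p q; rewrite -(free_reprK p) -(free_reprK q) -free_pi_cat.
by rewrite !free_lift_pi word_eval_cat.
Qed.

HB.instance Definition _ := isMultiplicative.Build free H free_lift free_liftM.

End Lift.

Lemma free_hom_ext (H : groupType) (f g : {multiplicative free -> H}) :
  (forall x, f (fgen x) = g (fgen x)) -> f =1 g.
Proof.
move=> fg p; rewrite -(free_reprK p).
elim: (free_repr p) => [|[x b] u IHu]; first by rewrite !hom1.
by rewrite free_pi_cons !gmulfM IHu; case: b; rewrite ?homV fg.
Qed.

End FreeGroup.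

(* The group of automorphisms of G, acting on the right: a * b is a followed
   by b, so its underlying function is aut_fun b \o aut_fun a. *)
Section Automorphisms.
Variable G : groupType.

Record aut : Type := Aut {
  aut_fun :> {multiplicative G -> G};
  aut_bij : bijective aut_fun }.

HB.instance Definition _ := gen_eqMixin aut.
HB.instance Definition _ := gen_choiceMixin aut.

Lemma aut_ext (a b : aut) : a =1 b -> a = b.
Proof.
case: a b => [[f [[fM]]] fB] [[g [[gM]]] gB] /= /funext fg.
move: fM fB gM gB; rewrite fg => fM fB gM gB.
by rewrite (Prop_irrelevance fM gM) in fB *; rewrite (Prop_irrelevance fB gB).
Qed.

Lemma aut_one_bij : bijective (idfun : {multiplicative G -> G}).
Proof. by exists idfun. Qed.
Definition aut_one : aut := Aut aut_one_bij.

Lemma aut_mul_bij (a b : aut) :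
  bijective ((aut_fun b \o aut_fun a) : {multiplicative G -> G}).
Proof. exact: bij_comp (aut_bij b) (aut_bij a). Qed.
Definition aut_mul (a b : aut) : aut := Aut (aut_mul_bij a b).

Lemma aut_inv_exists (a : aut) : exists b : aut, cancel a b /\ cancel b a.
Proof.
have [g ga ag] := aut_bij a.
have gM : {morph g : x y / x * y}.
  by move=> x y; apply: (bij_inj (aut_bij a)); rewrite gmulfM !ag.
pose gm := isMultiplicative.Build G G g gM.
pose g' : {multiplicative G -> G} := HB.pack g gm.
by exists (@Aut g' (Bijective ag ga)).
Qed.
Definition aut_inv (a : aut) : aut := projT1 (cid (aut_inv_exists a)).

Lemma aut_mulA : associative aut_mul.
Proof. by move=> a b c; apply: aut_ext. Qed.
Lemma aut_mul1 : left_id aut_one aut_mul.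
Proof. by move=> a; apply: aut_ext. Qed.
Lemma aut_1mul : right_id aut_one aut_mul.
Proof. by move=> a; apply: aut_ext. Qed.
Lemma aut_mulVg : left_inverse aut_one aut_inv aut_mul.
Proof.
move=> a; apply: aut_ext => x /=; rewrite /aut_inv.
by case: cid => b /= [_ ba]; rewrite ba.
Qed.
Lemma aut_mulgV : right_inverse aut_one aut_inv aut_mul.
Proof.
move=> a; apply: aut_ext => x /=; rewrite /aut_inv.
by case: cid => b /= [ab _]; rewrite ab.
Qed.

HB.instance Definition _ :=
  isGroup.Build aut aut_mulA aut_mul1 aut_1mul aut_mulVg aut_mulgV.

Lemma aut_mulE (a b : aut) x : (a * b) x = b (a x).
Proof. by []. Qed.

End Automorphisms.

Section LowerCentralSeries.
Local Open Scope classical_set_scope.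
Variable G : groupType.

Definition is_subgroup (H : set G) : Prop :=
  H 1 /\ forall x y, H x -> H y -> H (x * y^-1).

Definition ggenerated (A : set G) : set G := smallest is_subgroup A.

Definition gcommutator (A B : set G) : set G :=
  ggenerated [set [~ x, y] | x in A & y in B].

(* Indexed from 1, as usual; gamma 0 is a dummy value. *)
Definition gamma (i : nat) : set G :=
  iter i.-1 (fun H => gcommutator H [set: G]) [set: G].

End LowerCentralSeries.

Arguments gamma G i : clear implicits.

Section VirtualBraids.
Variable n : nat.

(* The index i : 'I_n.-1 stands for the (i+1)-st generator, which involves the
   strands strand i and strand_next i, i.e. i+1 and i+2 when counting from 1. *)
Lemma strand_subproof (i : 'I_n.-1) : i < n.
Proof. exact: leq_trans (ltn_ord i) (leq_pred n). Qed.
Lemma strand_next_subproof (i : 'I_n.-1) : i.+1 < n.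
Proof. by have := ltn_ord i; case: n i => [|m] [i]. Qed.

Definition strand (i : 'I_n.-1) : 'I_n := Ordinal (strand_subproof i).
Definition strand_next (i : 'I_n.-1) : 'I_n := Ordinal (strand_next_subproof i).

Definition far (i j : 'I_n.-1) : bool := (i.+1 < j) || (j.+1 < i).

Definition vb_gens : choiceType := ('I_n.-1 + 'I_n.-1)%type.
Definition sigma (i : 'I_n.-1) : free vb_gens := fgen (inl i : vb_gens).
Definition rho (i : 'I_n.-1) : free vb_gens := fgen (inr i : vb_gens).

Inductive vb_rel : free vb_gens -> free vb_gens -> Prop :=
| vb_sigma_braid (i j : 'I_n.-1) of j = i.+1 :> nat :
    vb_rel (sigma i * sigma j * sigma i) (sigma j * sigma i * sigma j)
| vb_sigma_far i j of far i j :
    vb_rel (sigma i * sigma j) (sigma j * sigma i)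
| vb_rho_invol i :
    vb_rel (rho i ^+ 2) 1
| vb_rho_far i j of far i j :
    vb_rel (rho i * rho j) (rho j * rho i)
| vb_rho_braid (i j : 'I_n.-1) of j = i.+1 :> nat :
    vb_rel (rho i * rho j * rho i) (rho j * rho i * rho j)
| vb_sigma_rho_far i j of far i j :
    vb_rel (sigma i * rho j) (rho j * sigma i)
| vb_mixed (i j : 'I_n.-1) of j = i.+1 :> nat :
    vb_rel (rho i * rho j * sigma i) (sigma j * rho i * rho j).

Definition VB : groupType := quot vb_rel.

Lemma strand_neq i : strand i != strand_next i.
Proof. by rewrite -val_eqE /= neq_ltn leqnn. Qed.

Lemma strand_nextE (i j : 'I_n.-1) : j = i.+1 :> nat -> strand j = strand_next i.
Proof. by move=> h; apply: val_inj. Qed.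

Lemma strand_neq2 (i j : 'I_n.-1) : j = i.+1 :> nat -> strand i != strand_next j.
Proof. by move=> h; rewrite -val_eqE /= h neq_ltn ltnW. Qed.

Lemma farP i j : far i j ->
  [/\ strand i != strand j, strand i != strand_next j,
      strand_next i != strand j & strand_next i != strand_next j].
Proof.
rewrite -!val_eqE /= /far !neq_ltn !ltnS => /orP[] h; split; apply/orP;
  by [left; rewrite // ltnW // ltnW | right; rewrite // ltnW // ltnW].
Qed.

(* F = <x_1, ..., x_n, y>; Some k is the index of x_k, and None that of y. *)
Definition F : groupType := free (option 'I_n).
Definition xgen (k : 'I_n) : F := fgen (Some k).
Definition ygen : F := fgen (None : option 'I_n).

Definition sigma_img (a b : 'I_n) (k : option 'I_n) : F :=
  if k is Some k then
    if k == a then xgen a * xgen b * (xgen a)^-1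
    else if k == b then xgen a
    else xgen k
  else ygen.

Definition rho_img (a b : 'I_n) (k : option 'I_n) : F :=
  if k is Some k then
    if k == a then xgen b ^ ygen^-1
    else if k == b then xgen a ^ ygen
    else xgen k
  else ygen.

Definition sigma_inv_img (a b : 'I_n) (k : option 'I_n) : F :=
  if k is Some k then
    if k == a then xgen b
    else if k == b then (xgen b)^-1 * xgen a * xgen b
    else xgen k
  else ygen.

Lemma free_lift_x (H : groupType) (f : option 'I_n -> H) k :
  free_lift f (xgen k) = f (Some k).
Proof. exact: free_lift_gen. Qed.
Lemma free_lift_y (H : groupType) (f : option 'I_n -> H) :
  free_lift f ygen = f None.
Proof. exact: free_lift_gen. Qed.

Lemma F_hom_ext (H : groupType) (f g : {multiplicative F -> H}) :
  (forall k, f (xgen k) = g (xgen k)) -> f ygen = g ygen -> f =1 g.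
Proof. by move=> fgx fgy; apply: free_hom_ext => -[k|]; [exact: fgx | exact: fgy]. Qed.

Lemma sigma_bij i :
  bijective (free_lift (sigma_img (strand i) (strand_next i))).
Proof.
have ab := strand_neq i; have ba := ab; rewrite eq_sym in ba.
move: (strand i) (strand_next i) ab ba => a b ab ba.
pose f : {multiplicative F -> F} := free_lift (sigma_img a b).
pose g : {multiplicative F -> F} := free_lift (sigma_inv_img a b).
exists g.
- apply: (@F_hom_ext _ (g \o f) idfun) => [k|] /=; last by rewrite !free_lift_y.
  rewrite free_lift_x /=; case: eqP => [->|/eqP ka].
    rewrite !gmulfM homV /= !free_lift_x /= !eqxx (negPf ba).
    by rewrite !mulgA mulgV mul1g mulgK.
  case: eqP => [->|/eqP kb]; first by rewrite free_lift_x /= eqxx.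
  by rewrite free_lift_x /= (negPf ka) (negPf kb).
- apply: (@F_hom_ext _ (f \o g) idfun) => [k|] /=; last by rewrite !free_lift_y.
  rewrite free_lift_x /=; case: eqP => [->|/eqP ka].
    by rewrite free_lift_x /= (negPf ba) eqxx.
  case: eqP => [->|/eqP kb].
    rewrite !gmulfM homV /= !free_lift_x /= !eqxx (negPf ba).
    by rewrite !mulgA mulVg mul1g mulgKV.
  by rewrite free_lift_x /= (negPf ka) (negPf kb).
Qed.

Lemma rho_bij i : bijective (free_lift (rho_img (strand i) (strand_next i))).
Proof.
have ba := strand_neq i; rewrite eq_sym in ba.
move: (strand i) (strand_next i) ba => a b ba.
pose f : {multiplicative F -> F} := free_lift (rho_img a b).
suff fK : cancel f f by exists f.
apply: (@F_hom_ext _ (f \o f) idfun) => [k|] /=; last by rewrite !free_lift_y.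
rewrite free_lift_x /=; case: eqP => [->|/eqP ka].
  rewrite /conjg !gmulfM !homV /= !free_lift_x free_lift_y /= eqxx (negPf ba).
  by rewrite /conjg !mulgA mulgK invgK mulgV mul1g.
case: eqP => [->|/eqP kb].
  rewrite /conjg !gmulfM !homV /= !free_lift_x free_lift_y /= eqxx.
  by rewrite /conjg !mulgA mulgKV invgK mulVg mul1g.
by rewrite free_lift_x /= (negPf ka) (negPf kb).
Qed.

Definition phi_gen (s : vb_gens) : aut F :=
  match s with
  | inl i => Aut (sigma_bij i)
  | inr i => Aut (rho_bij i)
  end.

Lemma F_aut_ext (a b : aut F) :
  (forall k, a (xgen k) = b (xgen k)) -> a ygen = b ygen -> a = b.
Proof. by move=> ex ey; apply: aut_ext; apply: F_hom_ext. Qed.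


Definition acts_as (img : option 'I_n -> F) (s : aut F) : Prop :=
  (forall k, s (xgen k) = img (Some k)) /\ s ygen = ygen.

Lemma phi_sigma_acts i :
  acts_as (sigma_img (strand i) (strand_next i)) (phi_gen (inl i)).
Proof. by split=> [k|]; [exact: free_lift_x | exact: free_lift_y]. Qed.
Lemma phi_rho_acts i :
  acts_as (rho_img (strand i) (strand_next i)) (phi_gen (inr i)).
Proof. by split=> [k|]; [exact: free_lift_x | exact: free_lift_y]. Qed.

Lemma mixed_acts (a b c : 'I_n) (r q s t : aut F) :
  a != b -> b != c -> a != c ->
  acts_as (rho_img a b) r -> acts_as (rho_img b c) q ->
  acts_as (sigma_img a b) s -> acts_as (sigma_img b c) t ->
  [/\ s * t * s = t * s * t, r * q * r = q * r * q & r * q * s = t * r * q].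
Proof.
move=> ab bc ac [rx ry] [qx qy] [sx sy] [tx ty].
have [ba cb ca] : [/\ b != a, c != b & c != a] by split; rewrite eq_sym.
have neqE := (negPf ab, negPf bc, negPf ac, negPf ba, negPf cb, negPf ca).
split; apply: F_aut_ext => [k|]; rewrite !aut_mulE ?(sy, ty, ry, qy) //;
  (have [->|ka] := eqVneq k a; last have [->|kb] := eqVneq k b;
   last have [->|kc] := eqVneq k c).
all: do 4? rewrite /conjg ?(gmulfM, homV, sx, tx, rx, qx, sy, ty, ry, qy) /=
    ?eqxx ?neqE /= ?(negPf ka, negPf kb, negPf kc).
all: by rewrite ?invMg ?invgK ?mulgA
  ?(mulgK, mulgKV, mulVg, mulgV, mul1g, mulg1).
Qed.

Lemma far_acts (a b c d : 'I_n) (img img' : 'I_n -> 'I_n -> option 'I_n -> F)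
    (s t : aut F) :
  a != b -> c != d -> [/\ a != c, a != d, b != c & b != d] ->
  img = sigma_img \/ img = rho_img -> img' = sigma_img \/ img' = rho_img ->
  acts_as (img a b) s -> acts_as (img' c d) t ->
  s * t = t * s.
Proof.
move=> ab cd [ac ad bc bd] imgE img'E [sx sy] [tx ty].
have [ba dc] : b != a /\ d != c by split; rewrite eq_sym.
have [ca da cb db] : [/\ c != a, d != a, c != b & d != b].
  by split; rewrite eq_sym.
have neqE := (negPf ab, negPf cd, negPf ac, negPf ad, negPf bc, negPf bd,
  (negPf ba, negPf dc, negPf ca, negPf da, negPf cb, negPf db)).
apply: F_aut_ext => [k|]; rewrite !aut_mulE ?(sy, ty) //.
case: imgE img'E sx tx => -> [] -> sx tx;
  (have [->|ka] := eqVneq k a; last have [->|kb] := eqVneq k b;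
   last have [->|kc] := eqVneq k c; last have [->|kd] := eqVneq k d).
all: by do 4? rewrite /conjg ?(gmulfM, homV, sx, tx, sy, ty) /=
    ?eqxx ?neqE /= ?(negPf ka, negPf kb, negPf kc, negPf kd).
Qed.

Lemma rho_invol_acts (a b : 'I_n) (r : aut F) :
  a != b -> acts_as (rho_img a b) r -> r ^+ 2 = 1.
Proof.
move=> ab [rx ry]; have ba : b != a by rewrite eq_sym.
apply: F_aut_ext => [k|]; rewrite expg2 !aut_mulE ?ry //.
have [->|ka] := eqVneq k a; last have [->|kb] := eqVneq k b.
all: do 4? rewrite /conjg ?(gmulfM, homV, rx, ry) /=
    ?eqxx ?(negPf ab, negPf ba) /= ?(negPf ka, negPf kb).
all: by rewrite ?invMg ?invgK ?mulgA
  ?(mulgK, mulgKV, mulVg, mulgV, mul1g, mulg1).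
Qed.

Lemma phi_rel u v : vb_rel u v -> free_lift phi_gen u = free_lift phi_gen v.
Proof.
have N := strand_neq.
have M (i j : 'I_n.-1) : j = i.+1 :> nat ->
  let s := phi_gen (inl i) in let t := phi_gen (inl j) in
  let r := phi_gen (inr i) in let q := phi_gen (inr j) in
  [/\ s * t * s = t * s * t, r * q * r = q * r * q & r * q * s = t * r * q].
  move=> ij s t r q; have ac := strand_neq2 ij.
  have bc : strand_next i != strand_next j by rewrite -(strand_nextE ij) N.
  have ht : acts_as (sigma_img (strand_next i) (strand_next j)) t.
    by rewrite -(strand_nextE ij); apply: phi_sigma_acts.
  have hq : acts_as (rho_img (strand_next i) (strand_next j)) q.
    by rewrite -(strand_nextE ij); apply: phi_rho_acts.
  exact: (mixed_acts (N i) bc ac (phi_rho_acts i) hq (phi_sigma_acts i) ht).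
case=> {u v} [i j ij|i j ij|i|i j ij|i j ij|i j ij|i j ij];
  rewrite ?gmulfM /= /sigma /rho ?free_lift_gen.
- by case: (M _ _ ij).
- by apply: (far_acts (N i) (N j) (farP ij) _ _ (phi_sigma_acts i)
    (phi_sigma_acts j)); [left | left].
- rewrite hom1; exact: rho_invol_acts (N i) (phi_rho_acts i).
- by apply: (far_acts (N i) (N j) (farP ij) _ _ (phi_rho_acts i)
    (phi_rho_acts j)); [right | right].
- by case: (M _ _ ij).
- by apply: (far_acts (N i) (N j) (farP ij) _ _ (phi_sigma_acts i)
    (phi_rho_acts j)); [left | right].
- by case: (M _ _ ij).
Qed.

Definition phi : {multiplicative VB -> aut F} := quot_lift phi_rel.

Definition perm_gen (s : vb_gens) : {perm 'I_n} :=
  match s with inl i | inr i => tperm (strand i) (strand_next i) end.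

Lemma perm_rel u v : vb_rel u v -> free_lift perm_gen u = free_lift perm_gen v.
Proof.
have N := strand_neq.
have B (a b c : 'I_n) : a != b -> b != c -> a != c ->
    tperm a b * tperm b c * tperm a b = tperm b c * tperm a b * tperm b c :> {perm 'I_n}.
  move=> ab bc ac.
  have -> : tperm a b * tperm b c * tperm a b = tperm b c ^ tperm a b :> {perm 'I_n}.
    by rewrite /conjg tpermV mulgA.
  have -> : tperm b c * tperm a b * tperm b c = tperm a b ^ tperm b c :> {perm 'I_n}.
    by rewrite /conjg tpermV mulgA.
  by rewrite !tpermJ !tpermR tpermL !tpermD // eq_sym.
have D (i j : 'I_n.-1) : far i j ->
    commute (tperm (strand i) (strand_next i)) (tperm (strand j) (strand_next j)).
  move=> /farP[ac ad bc bd]; apply/commgP/conjg_fixP.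
  by rewrite tpermJ !tpermD // eq_sym.
case=> {u v} [i j ij|i j ij|i|i j ij|i j ij|i j ij|i j ij];
  rewrite ?expg2 ?gmulfM ?hom1 /= /sigma /rho ?free_lift_gen /=;
  do ?[exact: D | exact: tperm2 | rewrite (strand_nextE ij); apply: B].
all: by rewrite ?N // -?(strand_nextE ij) ?N // strand_neq2.
Qed.

Definition vb_perm : {multiplicative VB -> {perm 'I_n}} := quot_lift perm_rel.

(* The closure of beta is a knot iff vb_perm beta is an n-cycle, i.e. has a
   cycle of length n. *)
Definition closes_to_knot (beta : VB) : Prop :=
  exists k : 'I_n, #|porbit (vb_perm beta) k| = n.

Definition G_A (beta : VB) : groupType :=
  quot (fun u v : F => exists k : 'I_n, u = xgen k /\ v = phi beta (xgen k)).

Definition G_Ka (beta : VB) : groupType :=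
  quot (fun u v : G_A beta => u = quot_pi _ ygen /\ v = 1).

End VirtualBraids.

Arguments phi {n}.
Arguments vb_perm {n}.

(* Main.v *)
Require Import Defs.
From mathcomp Require Import all_boot all_fingroup.
From mathcomp Require Import classical_sets.

(** The automorphism [phi beta] sends each [x_k] to a word that becomes a
    conjugate of [x_(p k)] once [y = 1], where [p] is the permutation of [beta].
    As [p] is an [n]-cycle, all the [x_k] are conjugate in the Kauffman group
    [G], which is therefore generated by a single [x_k] together with
    [gamma G 2].  This forces [gamma G 2 = gamma G 3]: modulo [gamma G 3], the
    centralizer of [x_k] contains [x_k] and [gamma G 2], hence is [G]; so the
    center contains [x_k] and [gamma G 2], hence is [G] as well. *)

Set Implicit Arguments.
Unset Strict Implicit.
Unset Printing Implicit Defensive.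

Local Open Scope group_scope.
Local Open Scope classical_set_scope.

Section Subgroups.
Variable G : groupType.
Implicit Types (A B N : set G) (x y g : G).

Lemma subgroupV A x : is_subgroup A -> A x -> A x^-1.
Proof. by move=> [A1 AB] Ax; rewrite -[x^-1]mul1g; apply: AB. Qed.

Lemma subgroupM A x y : is_subgroup A -> A x -> A y -> A (x * y).
Proof.
by move=> sA Ax Ay; rewrite -[y]invgK; apply: sA.2 => //; apply: subgroupV.
Qed.

Lemma ggenerated_subgroup A : is_subgroup (ggenerated A).
Proof.
split=> [|x y Ax Ay] B [sB AB]; first exact: sB.1.
by apply: sB.2; [apply: Ax | apply: Ay].
Qed.

Definition is_normal N : Prop :=
  is_subgroup N /\ forall x g, N x -> N (x ^ g).

Lemma gcommutator_normal A :
  (forall x g, A x -> A (x ^ g)) -> is_normal (gcommutator A [set: G]).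
Proof.
move=> AJ; have sC := ggenerated_subgroup [set [~ x, y] | x in A & y in [set: G]].
split=> // x g Cx; move: x Cx g.
(* The elements all of whose conjugates stay in the commutator subgroup form a subgroup, and it
   contains every commutator by [conjRg]. *)
apply: (@smallest_sub _ _ _ [set x | forall g, gcommutator A [set: G] (x ^ g)]).
  split=> [g|x y Cx Cy g]; first by rewrite conj1g; apply: sC.1.
  by rewrite conjMg conjVg; apply: sC.2; [apply: Cx | apply: Cy].
move=> _ [x Ax [y _ <-]] g; rewrite conjRg; apply: sub_gen_smallest.
by exists (x ^ g); [apply: AJ | exists (y ^ g)].
Qed.

Lemma mem_gcommutator A B x y : A x -> B y -> gcommutator A B [~ x, y].
Proof. by move=> Ax By; apply: sub_gen_smallest; exists x => //; exists y. Qed.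

Lemma gamma2_normal : is_normal (gamma G 2).
Proof. by apply: gcommutator_normal. Qed.

Lemma gamma3_normal : is_normal (gamma G 3).
Proof. by apply: gcommutator_normal; apply: gamma2_normal.2. Qed.

Lemma mem_gamma2 x y : gamma G 2 [~ x, y].
Proof. exact: mem_gcommutator. Qed.

Lemma mem_gamma3 y x : gamma G 2 x -> gamma G 3 [~ x, y].
Proof. by move=> xG; apply: mem_gcommutator. Qed.

(** This set is the preimage in [G] of the centralizer of [y] in [G / N], handled without forming
    the quotient. Normality absorbs the conjugation by [z^-1]. *)
Lemma centralizer_mod_subgroup N y :
  is_normal N -> is_subgroup [set x | N [~ x, y]].
Proof.
move=> [sN NJ]; split=> [|x z /= Nx Nz]; first by rewrite /= comm1g; apply: sN.1.
have -> : [~ x * z^-1, y] = ([~ x, y] * [~ z, y]^-1) ^ z^-1.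
  by rewrite !commgEl /conjg !invMg !invgK !mulgA !mulgK.
by apply: NJ; apply: sN.2.
Qed.

Lemma commg_mem_sym N x y : is_subgroup N -> N [~ x, y] -> N [~ y, x].
Proof.
move=> sN Nxy; rewrite (_ : [~ y, x] = [~ x, y]^-1); first exact: subgroupV.
by rewrite !commgEl /conjg !invMg !invgK !mulgA.
Qed.

(** The hypothesis says, as an induction principle, that [t] and [gamma G 2] generate [G]. *)
Lemma gamma2_eq_gamma3 t :
  (forall A, is_subgroup A -> A t -> gamma G 2 `<=` A -> forall x, A x) ->
  gamma G 2 = gamma G 3.
Proof.
move=> genG; have nG3 := gamma3_normal; have sG3 := nG3.1.
have cent_t : forall x, gamma G 3 [~ x, t].
  apply: (genG [set x | gamma G 3 [~ x, t]]) => [||x /(mem_gamma3 t)].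
  - exact: centralizer_mod_subgroup.
  - by rewrite /= commgg; apply: sG3.1.
  - by [].
have central y : forall x, gamma G 3 [~ x, y].
  apply: (genG [set x | gamma G 3 [~ x, y]]) => [||x /(mem_gamma3 y)].
  - exact: centralizer_mod_subgroup.
  - exact: (commg_mem_sym sG3 (cent_t y)).
  - by [].
have sub23 : gamma G 2 `<=` gamma G 3.
  by apply: smallest_sub => // _ [x _ [y _ <-]].
apply/seteqP; split=> //; apply: smallest_sub; first exact: gamma2_normal.1.
by move=> _ [x _ [y _ <-]]; apply: mem_gamma2.
Qed.

End Subgroups.

Lemma free_subgroupT (X : choiceType) (A : set (free X)) :
  is_subgroup A -> (forall x, A (fgen x)) -> forall p, A p.
Proof.
move=> sA Agen p; rewrite -(free_reprK p).
elim: (free_repr p) => [|[x b] u IHu]; first exact: sA.1.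
rewrite free_pi_cons; apply: subgroupM => //; case: b => //.
exact: subgroupV.
Qed.

Section VirtualBraidClosure.
Variable n : nat.

(* [a] permutes the classes of the [x_k] as [s] permutes the [k], once [y = 1]. *)
Definition permutes_conj (a : Defs.aut (F n)) (s : {perm 'I_n}) : Prop :=
  a (ygen n) = ygen n /\
  forall (H : groupType) (f : {multiplicative F n -> H}), f (ygen n) = 1 ->
    forall k, exists g, f (a (xgen k)) = f (xgen (s k)) ^ g.

Lemma permutes_conj_gen x : permutes_conj (phi_gen x) (perm_gen x).
Proof.
case: x => i.
  have [sx sy] := phi_sigma_acts i; split=> // H f fy k; rewrite sx /=.
  case: eqP => [->|/eqP ka].
    (* Only this case needs a nontrivial conjugator: a * b * a^-1 is [b ^ a^-1]. *)
    exists (f (xgen (strand i)))^-1.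
    by rewrite tpermL !gmulfM homV /conjg invgK mulgA.
  exists 1; rewrite conjg1; case: eqP => [->|/eqP kb]; first by rewrite tpermR.
  by rewrite tpermD // eq_sym.
have [rx ry] := phi_rho_acts i; split=> // H f fy k; rewrite rx /=; exists 1.
rewrite conjg1; case: eqP => [->|/eqP ka].
  by rewrite tpermL /conjg !gmulfM !homV fy !invg1 mul1g mulg1.
case: eqP => [->|/eqP kb]; last by rewrite tpermD // eq_sym.
by rewrite tpermR /conjg !gmulfM homV fy invg1 mul1g mulg1.
Qed.

(** Since [b] fixes [y], composing [f] with [b^-1] still kills [y], so both hypotheses apply to the
    composite. The division form is what [is_subgroup] asks for. *)
Lemma permutes_conj_div a b s t :
  permutes_conj a s -> permutes_conj b t -> permutes_conj (a * b^-1) (s * t^-1).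
Proof.
move=> [ay aP] [biy bP].
have bK : cancel b (b^-1) by move=> x; rewrite -aut_mulE mulgV.
have bVy : b^-1 (ygen n) = ygen n by rewrite -[in LHS]biy bK.
split=> [|H f fy k]; first by rewrite aut_mulE ay.
pose f' : {multiplicative F n -> H} := f \o aut_fun b^-1.
have f'y : f' (ygen n) = 1 by rewrite /f' /= bVy.
have [g eg] := aP _ f' f'y k.
(* [t] carries this index to [s k], which makes the two conjugacies composable. *)
have [h eh] := bP _ f' f'y (t^-1 (s k)).
exists (h^-1 * g); rewrite aut_mulE [LHS]eg permM conjgM; congr (_ ^ g).
by rewrite permKV in eh; rewrite -[LHS](conjgK h) -eh /f' /= bK.
Qed.

Lemma phi_permutes_conj (beta : VB n) : permutes_conj (phi beta) (vb_perm beta).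
Proof.
rewrite -(quot_reprK beta) [phi _]quot_liftE [vb_perm _]quot_liftE.
move: (quot_repr beta); apply: (free_subgroupT (A := [set w | permutes_conj _ _])).
  split=> [|u v Pu Pv] /=.
    rewrite !hom1; split=> // H f fy k; exists 1.
    by rewrite conjg1 perm1.
  rewrite !gmulfM !homV; exact: permutes_conj_div.
by move=> x; rewrite /= !free_lift_gen; apply: permutes_conj_gen.
Qed.

Definition pi_Ka (beta : VB n) : {multiplicative F n -> G_Ka beta} :=
  @quot_pi (G_A beta) _ \o @quot_pi (F n) _.

Lemma pi_Ka_ind (beta : VB n) (A : set (G_Ka beta)) :
  is_subgroup A -> (forall k, A (pi_Ka beta (xgen k))) -> forall x, A x.
Proof.
move=> sA Ax x; rewrite -(quot_reprK x) -(quot_reprK (quot_repr x)).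
move: (quot_repr _); apply: (free_subgroupT (A := [set w | A (pi_Ka beta w)])).
  split=> [|u v Au Av]; first by rewrite /mkset hom1; apply: sA.1.
  by rewrite /mkset gmulfM homV; apply: sA.2.
case=> [k|]; first exact: Ax.
(* The remaining generator [y] is trivial in the Kauffman group. *)
have -> : [set w | A (pi_Ka beta w)] (ygen n) = A 1; last exact: sA.1.
by congr A; apply/quot_piP/congr_base.
Qed.

(** The relation [x_k = phi beta x_k] of [G_A] turns conjugacy of the image of [x_k] into conjugacy
    of [x_k] itself. *)
Lemma pi_Ka_conj (beta : VB n) k :
  exists g, pi_Ka beta (xgen k) = pi_Ka beta (xgen (vb_perm beta k)) ^ g.
Proof.
have [_ P] := phi_permutes_conj beta.
have [|g eg] := P _ (pi_Ka beta) _ k; first exact/quot_piP/congr_base.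
exists g; rewrite -[RHS]eg; congr quot_pi.
by apply/quot_piP/congr_base; exists k.
Qed.

End VirtualBraidClosure.

Theorem proposition2p1 (n : nat) (beta : VB n) (hK : closes_to_knot beta) :
  gamma (G_Ka beta) 2 = gamma (G_Ka beta) 3.
Proof.
case: hK => k0 orb; pose x k := pi_Ka beta (xgen k).
have conj_x k : exists g, x k = x k0 ^ g.
  have /porbitP[i ->] : k \in porbit (vb_perm beta) k0.
    suff -> : porbit (vb_perm beta) k0 = [set: 'I_n]%SET by rewrite finset.in_setT.
    by apply/eqP; rewrite eqEcard finset.subsetT cardsT card_ord orb leqnn.
  (* Conjugators accumulate along the cycle, one application of the permutation at a time. *)
  elim: i => [|i [g IHi]]; first by exists 1; rewrite conjg1 expg0 perm1.
  have [h eh] := pi_Ka_conj beta ((vb_perm beta ^+ i) k0).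
  exists (g * h^-1); rewrite conjgM -IHi expgSr permM.
  by rewrite /x eh conjgK.
apply: (@gamma2_eq_gamma3 _ (x k0)) => A sA Ax0 A2.
apply: pi_Ka_ind => // k; have [g eg] := conj_x k.
(* A conjugate differs from [x k0] by a commutator: [x k0 ^ g = x k0 * [~ x k0, g]]. *)
rewrite -/(x k) eg -[x k0 ^ g](mulKVg (x k0)) -commgEl.
exact: (subgroupM sA Ax0 (A2 _ (mem_gamma2 _ _))).
Qed.
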